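(* Let $A$ be a $3\times 3$ matrix with entries in the quaternions $\mathbb{H}$. If $A$ has some zero entry outside the diagonal, then $A$ admits a polynomial characteristic map.
   Context: For an $n\times n$ quaternionic matrix $M=X+\mathbf{j}Y$ with $X,Y$ complex $n\times n$ matrices, Study's determinant is the non-negative real number $\mathrm{Sdet}(M)=(\det c(M))^{1/2}$, where $c(M)=\begin{bmatrix} X & -\overline{Y}\\ Y&\overline{X}\end{bmatrix}$ is a complex $2n\times 2n$ matrix. A map $\mu\colon\mathbb{H}\to\mathbb{H}$ is a characteristic map of the $n\times n$ quaternionic matrix $A$ if, up to a (positive) constant factor, $|\mu(\lambda)|=\mathrm{Sdet}(A-\lambda\,\mathrm{Id})$ for all $\lambda\in\mathbb{H}$. A map $\mathbb{H}\to\mathbb{H}$ is polynomial if it is a finite sum of monomials $\lambda\mapsto q_0\lambda q_1\lambda\cdots\lambda q_k$ with $k\ge 0$ and $q_0,\dots,q_k\in\mathbb{H}$. *)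

(* Defs.v *)
From HB Require Import structures.
From mathcomp Require Import all_boot all_order all_algebra.
From mathcomp Require Import reals complex ring.
Set Implicit Arguments.
Unset Strict Implicit.
Unset Printing Implicit Defensive.
Import Order.TTheory GRing.Theory Num.Theory.
Local Open Scope ring_scope.
Local Open Scope complex_scope.

(* Quat a b c d is the quaternion a + b i + c j + d k. *)
Record quat (R : realType) :=
  Quat { quat_re : R; quat_i : R; quat_j : R; quat_k : R }.

Section QuatRing.
Variable R : realType.
Implicit Types p q r : quat R.

Definition tuple_of_quat q := (quat_re q, quat_i q, quat_j q, quat_k q).
Definition quat_of_tuple (t : R * R * R * R) :=
  Quat t.1.1.1 t.1.1.2 t.1.2 t.2.
Lemma tuple_of_quatK : cancel tuple_of_quat quat_of_tuple.
Proof. by case. Qed.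
HB.instance Definition _ := Choice.copy (quat R) (can_type tuple_of_quatK).

Definition quat_add p q :=
  Quat (quat_re p + quat_re q) (quat_i p + quat_i q)
       (quat_j p + quat_j q) (quat_k p + quat_k q).
Definition quat_opp q :=
  Quat (- quat_re q) (- quat_i q) (- quat_j q) (- quat_k q).
Definition quat_mul p q :=
  Quat (quat_re p * quat_re q - quat_i p * quat_i q
        - quat_j p * quat_j q - quat_k p * quat_k q)
       (quat_re p * quat_i q + quat_i p * quat_re q
        + quat_j p * quat_k q - quat_k p * quat_j q)
       (quat_re p * quat_j q - quat_i p * quat_k q
        + quat_j p * quat_re q + quat_k p * quat_i q)
       (quat_re p * quat_k q + quat_i p * quat_j q
        - quat_j p * quat_i q + quat_k p * quat_re q).

Lemma quat_addA : associative quat_add.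
Proof. by move=> [????] [????] [????]; congr Quat; exact: addrA. Qed.
Lemma quat_addC : commutative quat_add.
Proof. by move=> [????] [????]; congr Quat; exact: addrC. Qed.
Lemma quat_add0 : left_id (Quat 0 0 0 0) quat_add.
Proof. by move=> [????]; congr Quat; exact: add0r. Qed.
Lemma quat_addN : left_inverse (Quat 0 0 0 0) quat_opp quat_add.
Proof. by move=> [????]; congr Quat; exact: addNr. Qed.
HB.instance Definition _ := GRing.isZmodule.Build (quat R)
  quat_addA quat_addC quat_add0 quat_addN.

Lemma quat_mulA : associative quat_mul.
Proof. by move=> [????] [????] [????]; congr Quat => /=; ring. Qed.
Lemma quat_mul1l : left_id (Quat 1 0 0 0) quat_mul.
Proof. by move=> [????]; congr Quat => /=; ring. Qed.
Lemma quat_mul1r : right_id (Quat 1 0 0 0) quat_mul.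
Proof. by move=> [????]; congr Quat => /=; ring. Qed.
Lemma quat_mulDl : left_distributive quat_mul quat_add.
Proof. by move=> [????] [????] [????]; congr Quat => /=; ring. Qed.
Lemma quat_mulDr : right_distributive quat_mul quat_add.
Proof. by move=> [????] [????] [????]; congr Quat => /=; ring. Qed.
Lemma quat_oner_neq0 : Quat 1 0 0 0 != 0 :> quat R.
Proof. by apply/eqP => -[/eqP]; rewrite oner_eq0. Qed.
HB.instance Definition _ := GRing.Zmodule_isNzRing.Build (quat R)
  quat_mulA quat_mul1l quat_mul1r quat_mulDl quat_mulDr quat_oner_neq0.

Definition quat_norm q : R :=
  Num.sqrt (quat_re q ^+ 2 + quat_i q ^+ 2 + quat_j q ^+ 2 + quat_k q ^+ 2).

Definition quat_of_complex (z : R[i]) : quat R :=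
  Quat (complex.Re z) (complex.Im z) 0 0.

(* The unique decomposition q = x + j y with x, y complex; the imaginary part
   of y changes sign because j i = - k. *)
Definition cpart q : R[i] := quat_re q +i* quat_i q.
Definition jpart q : R[i] := quat_j q -i* quat_k q.

Lemma quat_cjE q :
  q = quat_of_complex (cpart q) + Quat 0 0 1 0 * quat_of_complex (jpart q).
Proof. by case: q => a b c d; congr Quat => /=; ring. Qed.

End QuatRing.

Definition cmx (R : realType) (n : nat) (M : 'M[quat R]_n) : 'M[R[i]]_(n + n) :=
  let X := map_mx (@cpart R) M in
  let Y := map_mx (@jpart R) M in
  block_mx X (- map_mx conjc Y) Y (map_mx conjc X).

(* The determinant is a nonnegative real, and sqrtC is then its nonnegative
   square root; the value is kept in R[i]. *)
Definition Sdet (R : realType) (n : nat) (M : 'M[quat R]_n) : R[i] :=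
  sqrtC (\det (cmx M)).

Definition characteristic_map (R : realType) (n : nat) (A : 'M[quat R]_n)
    (mu : quat R -> quat R) : Prop :=
  exists2 c : R, 0 < c &
    forall l : quat R, (quat_norm (mu l))%:C = c%:C * Sdet (A - l%:M).

(* qmonomial q0 [:: q1; ...; qk] l = q0 l q1 l ... l qk *)
Definition qmonomial (R : realType) (q0 : quat R) (s : seq (quat R))
    (l : quat R) : quat R :=
  foldl (fun p q => p * l * q) q0 s.

Definition polynomial_map (R : realType) (f : quat R -> quat R) : Prop :=
  exists ms : seq (quat R * seq (quat R)),
    forall l, f l = \sum_(m <- ms) qmonomial m.1 m.2 l.

(* Main.v *)
From HB Require Import structures.
Require Import Defs.
From mathcomp Require Import all_boot all_order all_algebra.
From mathcomp Require Import perm reals complex ring.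
Import GRing.Theory Num.Theory.
Local Open Scope ring_scope.

(** Exchanging two indices, the same for rows and columns, amounts to
    conjugating by a permutation matrix and leaves Study's determinant
    unchanged; so the zero entry of A may be assumed to be the upper right one.
    Then A - l is lower Hessenberg (zero above the superdiagonal), and its
    superdiagonal entries do not involve l.

    For any lower Hessenberg family M l of quaternionic matrices with entries
    polynomial in l and superdiagonal independent of l, \det (c (M l)) is the
    squared norm of a polynomial map ([det_cmx_hessenberg]). This goes by
    induction on the size. Let a l and b be the first two entries of the first
    row, the other ones being zero. If b = 0, the matrix is block triangular
    and the polynomial map is a times that of the smaller matrix. If b <> 0,
    subtracting from the first column the second one multiplied on the right by
    b^-1 (a l) leaves b alone in the first row, which can be expanded. What is
    left is again lower Hessenberg with the same kind of superdiagonal: its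
    first column is the only one that was modified. It is here that the
    superdiagonal has to be constant: the inverse of b is then a constant too,
    and the new entries remain polynomial.

    The properties of determinants over the noncommutative quaternions which
    this uses all come from the complex matrices c(M): c is multiplicative
    ([cmxM]), \det (c(P)) = 1 for permutation matrices, and \det (c(M)) is
    multiplicative on block triangular matrices ([det_cmx_lblock]). Working
    with \det (c(M)) rather than with its square root avoids any question of
    sign, until it is known to be a squared norm. *)

(** * Polynomial maps of one quaternionic variable *)

Lemma polynomial_ext {R : realType} (f g : quat R -> quat R) :
  f =1 g -> polynomial_map f -> polynomial_map g.
Proof. by move=> fg [ms fE]; exists ms => l; rewrite -fg. Qed.

Lemma polynomial_cst {R : realType} (c : quat R) : polynomial_map (fun=> c).
Proof. by exists [:: (c, [::])] => l; rewrite big_seq1. Qed.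

Lemma polynomial_id {R : realType} : polynomial_map (fun l : quat R => l).
Proof.
by exists [:: (1, [:: 1])] => l; rewrite big_seq1 /qmonomial /= mul1r mulr1.
Qed.

Lemma polynomialD {R : realType} (f g : quat R -> quat R) :
  polynomial_map f -> polynomial_map g -> polynomial_map (fun l => f l + g l).
Proof.
by move=> [ms fE] [ns gE]; exists (ms ++ ns) => l; rewrite big_cat fE gE.
Qed.

Lemma polynomial_sum {R : realType} (T : Type) (s : seq T)
    (F : T -> quat R -> quat R) :
  (forall x, polynomial_map (F x)) ->
  polynomial_map (fun l => \sum_(x <- s) F x l).
Proof.
move=> Fpoly; elim: s => [|x s IHs].
  by apply: polynomial_ext (polynomial_cst 0) => l; rewrite big_nil.
by apply: polynomial_ext (polynomialD _ _ (Fpoly x) IHs) => l; rewrite big_cons.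
Qed.

(** A constant factor on the right is absorbed by the last coefficient of each
    monomial, which is the leading one when the monomial is constant. *)
Lemma polynomialMcst {R : realType} (f : quat R -> quat R) c :
  polynomial_map f -> polynomial_map (fun l => f l * c).
Proof.
move=> [ms fE].
apply: (@polynomial_ext _ (fun l => \sum_(m <- ms) qmonomial m.1 m.2 l * c)).
  by move=> l; rewrite fE mulr_suml.
apply: polynomial_sum => -[q0 s] /=; case/lastP: s => [|s q].
  exact: (polynomial_cst (q0 * c)).
exists [:: (q0, rcons s (q * c))] => l.
by rewrite big_seq1 /qmonomial /= !foldl_rcons mulrA.
Qed.

Lemma polynomialMvar {R : realType} (f : quat R -> quat R) :
  polynomial_map f -> polynomial_map (fun l => f l * l).
Proof.
move=> [ms fE].
exists [seq (m.1, rcons m.2 1) | m <- ms] => l.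
rewrite fE mulr_suml big_map; apply: eq_bigr => m _.
by rewrite /qmonomial foldl_rcons mulr1.
Qed.

(** A product with a monomial is a succession of right multiplications by
    constants and by the variable. *)
Lemma polynomialM {R : realType} (f g : quat R -> quat R) :
  polynomial_map f -> polynomial_map g -> polynomial_map (fun l => f l * g l).
Proof.
move=> fpoly [ns gE].
apply: (@polynomial_ext _ (fun l => \sum_(m <- ns) f l * qmonomial m.1 m.2 l)).
  by move=> l; rewrite gE mulr_sumr.
apply: polynomial_sum => -[q0 s] /=; elim/last_ind: s => [|s q IHs].
  exact: polynomialMcst.
apply: polynomial_ext (polynomialMcst _ q (polynomialMvar _ IHs)) => l.
by rewrite /qmonomial foldl_rcons !mulrA.
Qed.

(** * Quaternions: squared norm, inverses and complex parts *)

Definition quat_normsq {R : realType} (q : quat R) : R :=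
  quat_re q ^+ 2 + quat_i q ^+ 2 + quat_j q ^+ 2 + quat_k q ^+ 2.

Lemma quat_normsqM {R : realType} (p q : quat R) :
  quat_normsq (p * q) = quat_normsq p * quat_normsq q.
Proof. by case: p q => [????] [????]; rewrite /quat_normsq /=; ring. Qed.

Lemma quat_normsq_ge0 {R : realType} (q : quat R) : 0 <= quat_normsq q.
Proof. by rewrite /quat_normsq !addr_ge0 ?sqr_ge0. Qed.

Lemma quat_normsq_eq0 {R : realType} (q : quat R) :
  (quat_normsq q == 0) = (q == 0).
Proof.
apply/eqP/eqP=> [|->]; last by rewrite /quat_normsq /= expr0n /= !addr0.
case: q => a b c d; rewrite /quat_normsq /= => /eqP.
rewrite !paddr_eq0 ?addr_ge0 ?sqr_ge0// !sqrf_eq0.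
by move=> /andP[/andP[/andP[/eqP-> /eqP->] /eqP->] /eqP->].
Qed.

Lemma quat_right_inverse {R : realType} (b : quat R) :
  b != 0 -> exists c, b * c = 1.
Proof.
rewrite -quat_normsq_eq0; case: b => x y z t; rewrite /quat_normsq /=.
set N := (X in X != 0) => N0.
(* The conjugate divided by the squared norm. *)
exists (Quat (x / N) (- y / N) (- z / N) (- t / N)).
by congr Quat => /=; rewrite /N; field.
Qed.

(** These are the block product rules of c: writing p = x + j y, one has
    z j = j z^* for every complex z. *)
Lemma cpartM_jpartM {R : realType} (p q : quat R) :
  cpart (p * q) = cpart p * cpart q - (jpart p)^*%C * jpart q /\
  jpart (p * q) = jpart p * cpart q + (cpart p)^*%C * jpart q.
Proof.
case: p q => [a b c d] [a' b' c' d'].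
by split; apply/eqP; rewrite eq_complex /=; apply/andP; split; apply/eqP; ring.
Qed.

Fact cpart_is_additive {R : realType} : zmod_morphism (@cpart R).
Proof. by case=> [????] [????]. Qed.
HB.instance Definition _ (R : realType) :=
  GRing.isZmodMorphism.Build (quat R) R[i] (@cpart R) cpart_is_additive.
Fact jpart_is_additive {R : realType} : zmod_morphism (@jpart R).
Proof.
by case=> [????] [????]; apply/eqP; rewrite eq_complex /= opprD !eqxx.
Qed.
HB.instance Definition _ (R : realType) :=
  GRing.isZmodMorphism.Build (quat R) R[i] (@jpart R) jpart_is_additive.

(** * The determinant of the complex matrix of a quaternionic matrix *)

Lemma cmxM {R : realType} {n} (M N : 'M[quat R]_n) :
  cmx (M *m N) = cmx M *m cmx N.
Proof.
have cE : map_mx (@cpart R) (M *m N) =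
    map_mx (@cpart R) M *m map_mx (@cpart R) N
    - map_mx conjc (map_mx (@jpart R) M) *m map_mx (@jpart R) N.
  apply/matrixP=> i j; rewrite !mxE raddf_sum -sumrB.
  by apply: eq_bigr => k _; rewrite !mxE /= (cpartM_jpartM _ _).1.
have jE : map_mx (@jpart R) (M *m N) =
    map_mx (@jpart R) M *m map_mx (@cpart R) N
    + map_mx conjc (map_mx (@cpart R) M) *m map_mx (@jpart R) N.
  apply/matrixP=> i j; rewrite !mxE raddf_sum -big_split.
  by apply: eq_bigr => k _; rewrite !mxE /= (cpartM_jpartM _ _).2.
have conjK m p (X : 'M[R[i]]_(m, p)) : map_mx conjc (map_mx conjc X) = X.
  by apply/matrixP=> i j; rewrite !mxE conjcK.
rewrite /cmx cE jE mulmx_block !(map_mxM, map_mxD, map_mxB, map_mxN) !conjK.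
rewrite !mulNmx !mulmxN opprD (addrC (- _)) [in X in block_mx _ _ _ X = _]addrC.
reflexivity.
Qed.

Lemma det_cmxM {R : realType} {n} (M N : 'M[quat R]_n) :
  \det (cmx (M *m N)) = \det (cmx M) * \det (cmx N).
Proof. by rewrite cmxM det_mulmx. Qed.

(** The matrix of a permutation matrix consists of two diagonal copies of it,
    whose signs cancel. *)
Lemma det_cmx_perm {R : realType} {n} (s : 'S_n) :
  \det (cmx (perm_mx s : 'M[quat R]_n)) = 1.
Proof.
have cE : map_mx (@cpart R) (perm_mx s) = perm_mx s.
  by apply/matrixP=> i j; rewrite !mxE; case: (_ == _).
have jE : map_mx (@jpart R) (perm_mx s) = 0.
  apply/matrixP=> i j; rewrite !mxE; case: (_ == _) => /=;
  by apply/eqP; rewrite eq_complex /= oppr0 !eqxx.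
rewrite /cmx cE jE !map_mx0 oppr0 map_perm_mx det_lblock det_perm.
by rewrite -expr2 sqrr_sign.
Qed.

Lemma det_cmx_mxsub {R : realType} {n} (s t : 'S_n) (M : 'M[quat R]_n) :
  \det (cmx (\matrix_(i, j) M (s i) (t j))) = \det (cmx M).
Proof.
have -> : (\matrix_(i, j) M (s i) (t j))
    = perm_mx s *m M *m perm_mx (t^-1)%g.
  rewrite -row_permE -col_permE.
  by apply/matrixP=> i j; rewrite !mxE.
by rewrite !det_cmxM !det_cmx_perm mul1r mulr1.
Qed.

(** A change of basis between index types that are equal in size but not
    convertible, such as (m + m) + (n + n) and (m + n) + (m + n). *)
Lemma det_cast_conj {K : comPzRingType} {k l} (P : 'M[K]_(k, l)) (Q : 'M[K]_(l, k))
    (A : 'M[K]_l) :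
  k = l -> P *m Q = 1%:M -> \det (P *m A *m Q) = \det A.
Proof.
move=> kl; case: l / kl P Q A => P Q A PQ.
by rewrite !det_mulmx mulrAC -det_mulmx PQ det1 mul1r.
Qed.

(** Listing the indices of the two m-blocks before those of the two n-blocks
    makes the matrix block lower triangular; this is the conjugation by P. *)
Lemma det_block_shuffle {K : comPzRingType} {m n}
    (A1 A2 A3 A4 : 'M[K]_m) (C1 C2 C3 C4 : 'M[K]_(n, m)) (B1 B2 B3 B4 : 'M[K]_n) :
  \det (block_mx (block_mx A1 0 C1 B1) (block_mx A2 0 C2 B2)
                 (block_mx A3 0 C3 B3) (block_mx A4 0 C4 B4)) =
  \det (block_mx A1 A2 A3 A4) * \det (block_mx B1 B2 B3 B4).
Proof.
pose P : 'M[K]_((m + m) + (n + n), (m + n) + (m + n)) :=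
  block_mx (block_mx 1%:M 0 0 0) (block_mx 0 0 1%:M 0)
           (block_mx 0 1%:M 0 0) (block_mx 0 0 0 1%:M).
set A := (X in \det X = _).
have PPt : P *m P^T = 1%:M.
  rewrite /P !tr_block_mx !trmx1 !trmx0.
  rewrite !(mulmx_block, mul1mx, mulmx1, mul0mx, mulmx0, addr0, add0r,
            add_block_mx).
  by rewrite !block_mx0 -!scalar_mx_block.
rewrite -(det_cast_conj P _ A (addnACA m m n n) PPt).
rewrite /P !tr_block_mx !trmx1 !trmx0.
rewrite !(mulmx_block, mul1mx, mulmx1, mul0mx, mulmx0, addr0, add0r,
          add_block_mx).
by rewrite block_mx0 det_lblock.
Qed.

Lemma det_cmx_lblock {R : realType} {m n} (A : 'M[quat R]_m)
    (C : 'M[quat R]_(n, m)) (B : 'M[quat R]_n) :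
  \det (cmx (block_mx A 0 C B)) = \det (cmx A) * \det (cmx B).
Proof.
rewrite /cmx !map_block_mx !map_mx0 opp_block_mx oppr0.
exact: det_block_shuffle.
Qed.

Lemma det_block1x1 {K : comPzRingType} (a b c d : 'M[K]_1) :
  \det (block_mx a b c d) = a 0 0 * d 0 0 - b 0 0 * c 0 0.
Proof.
have det2 (X : 'M[K]_(1 + 1)) : let l := lshift 1 0 in let r := rshift 1 0 in
    \det X = X l l * X r r - X l r * X r l.
  rewrite (expand_det_row _ 0) big_ord_recl big_ord1 /cofactor !det_mx11 !mxE /=.
  rewrite expr0 expr1 mul1r mulN1r mulrN.
  by congr (X _ _ * X _ _ - X _ _ * X _ _); apply: val_inj.
by rewrite det2 block_mxEul block_mxEur block_mxEdl block_mxEdr.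
Qed.

Lemma det_cmx1x1 {R : realType} (M : 'M[quat R]_1) :
  \det (cmx M) = (quat_normsq (M 0 0))%:C%C.
Proof.
rewrite /cmx det_block1x1 !mxE; case: (M 0 0) => a b c d.
by apply/eqP; rewrite eq_complex /quat_normsq /=; apply/andP; split; apply/eqP; ring.
Qed.

Lemma det_cmx_first_row {R : realType} {n} (M : 'M[quat R]_n.+1) :
  (forall j, M 0 (lift 0 j) = 0) ->
  \det (cmx M) = (quat_normsq (M 0 0))%:C%C *
    \det (cmx (\matrix_(i, j) M (lift 0 i) (lift 0 j))).
Proof.
move=> M0; have ur0 : @ursubmx _ 1 n 1 n M = 0.
  apply/matrixP => i j; rewrite !mxE ord1 rshift1 -[RHS](M0 j).
  by congr (M _ _); apply: val_inj.
have := det_cmx_lblock (@ulsubmx _ 1 n 1 n M) (@dlsubmx _ 1 n 1 n M)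
                       (@drsubmx _ 1 n 1 n M).
rewrite -ur0 submxK det_cmx1x1 => ->; congr (_ * _).
  by rewrite !mxE; congr (quat_normsq (M _ _))%:C%C; apply: val_inj.
by congr (\det (cmx _)); apply/matrixP=> i j; rewrite !mxE !rshift1.
Qed.

(** The column operation that clears the corner M 0 0 by means of M 0 1; the
    first two columns are then exchanged and the first row is expanded. Scalars
    act on columns from the right, so that the operation is a product with an
    elementary matrix on the right. *)
Lemma det_cmx_col_op {R : realType} {n} (M : 'M[quat R]_n.+2) (t : quat R) :
  M 0 0 + M 0 (lift 0 0) * t = 0 ->
  (forall j : 'I_n, M 0 (lift 0 (lift 0 j)) = 0) ->
  \det (cmx M) = (quat_normsq (M 0 (lift 0 0)))%:C%C *
    \det (cmx (\matrix_(i, j < n.+1)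
      if j == 0 then M (lift 0 i) 0 + M (lift 0 i) (lift 0 0) * t
      else M (lift 0 i) (lift 0 j))).
Proof.
move=> M00 M0.
have [M1 M1E <-] : exists2 M1 : 'M[quat R]_n.+2,
    forall i j, M1 i j = if j == 0 then M i 0 + M i (lift 0 0) * t else M i j
    & \det (cmx M1) = \det (cmx M).
  pose E : 'M[quat R]_n.+2 := 1%:M +
    \matrix_(k, j) if (k == lift 0 0) && (j == 0) then t else 0.
  exists (M *m E).
    move=> i j; rewrite mulmxDr mulmx1 !mxE (bigD1 (lift 0 0)) //= big1.
      rewrite mxE eqxx addr0 /=.
      by case: eqP => [->|_] //; rewrite mulr0 addr0.
    by move=> k /negPf k1; rewrite mxE k1 mulr0.
  rewrite det_cmxM [X in _ * X]det_cmx_first_row; last first.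
    by move=> j; rewrite !mxE /= addr0.
  rewrite (_ : \matrix_(i, j) _ = perm_mx 1%g); last first.
    by apply/matrixP=> i j; rewrite !mxE andbF addr0 perm1 (inj_eq lift_inj) eq_sym.
  rewrite det_cmx_perm !mxE /= addr0 /quat_normsq /= expr0n expr1n /= !addr0.
  by rewrite !mulr1.
rewrite -(det_cmx_mxsub 1 (tperm 0 (lift 0 0))) det_cmx_first_row.
  rewrite !mxE perm1 tpermL M1E; congr (_ * _).
  congr (\det (cmx _)); apply/matrixP=> i j; rewrite !mxE perm1 M1E.
  have [->|j0] := eqVneq j 0; first by rewrite tpermR.
  by rewrite tpermD // (inj_eq lift_inj) eq_sym.
move=> j; rewrite !mxE perm1 M1E.
have [->|j0] := eqVneq j 0; first by rewrite tpermR.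
rewrite tpermD //=; last by rewrite (inj_eq lift_inj) eq_sym.
by case: (unliftP 0 j) j0 => [k -> _|->]; rewrite ?M0 ?eqxx.
Qed.

(** * Hessenberg families *)

(** The last condition says that the superdiagonal does not depend on l, its
    value being read off at l = 0. *)
Definition lower_hessenberg_polynomial {R : realType} {n}
    (M : quat R -> 'M[quat R]_n) :=
  [/\ forall i j, polynomial_map (fun l => M l i j),
      forall l (i j : 'I_n), (i.+1 < j)%N -> M l i j = 0
    & forall l (i j : 'I_n), j = i.+1 :> nat -> M l i j = M 0 i j].

(** Each step of the induction divides only by an entry of the superdiagonal,
    and modifies only the first column of what is left. *)
Lemma det_cmx_hessenberg {R : realType} {n} (M : quat R -> 'M[quat R]_n.+1) :
  lower_hessenberg_polynomial M ->
  exists2 mu, polynomial_map mu &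
    forall l, \det (cmx (M l)) = (quat_normsq (mu l))%:C%C.
Proof.
elim: n M => [|n IHn] M [Mpoly M0 Mcst].
  by exists (fun l => M l 0 0) => // l; apply: det_cmx1x1.
have row0 l j : M l 0 (lift 0 (lift 0 j)) = 0 by apply: M0.
have row1 l : M l 0 (lift 0 0) = M 0 0 (lift 0 0) by apply: Mcst.
have [b0|/quat_right_inverse[c bc]] := eqVneq (M 0 0 (lift 0 0)) 0.
  have [|mu mupoly muE] := IHn (fun l => \matrix_(i, j) M l (lift 0 i) (lift 0 j)).
    split=> [i j|l i j ij|l i j ij].
    - by apply: polynomial_ext (Mpoly (lift 0 i) (lift 0 j)) => l; rewrite mxE.
    - by rewrite mxE M0.
    - by rewrite !mxE Mcst // !lift0 ij.
  exists (fun l => M l 0 0 * mu l); first exact: polynomialM.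
  move=> l; rewrite det_cmx_first_row => [|j].
    by rewrite muE quat_normsqM rmorphM.
  by case: (unliftP 0 j) => [k ->|->]; rewrite ?row0 ?row1.
(* c is the inverse of b, so t l solves a l + b * t l = 0. *)
pose t l := - c * M l 0 0.
have tpoly : polynomial_map t.
  by apply: polynomialM (Mpoly _ _); apply: polynomial_cst.
have [|mu mupoly muE] := IHn (fun l => \matrix_(i, j)
    if j == 0 then M l (lift 0 i) 0 + M l (lift 0 i) (lift 0 0) * t l
    else M l (lift 0 i) (lift 0 j)).
  split=> [i j|l i j ij|l i j ij].
  - have [j0|j0] := eqVneq j 0.
      apply: (polynomial_ext _ _ (fun l => esym (mxE _ _ _ _))).
      rewrite j0 /=; apply: polynomialD => //.
      exact: polynomialM.
    apply: polynomial_ext (Mpoly (lift 0 i) (lift 0 j)) => l.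
    by rewrite mxE (negPf j0).
  - by rewrite mxE; case: eqP ij => [->|_ ij] //; rewrite M0.
  - rewrite !mxE; case: eqP ij => [->|_ ij] //.
    by rewrite Mcst // !lift0 ij.
exists (fun l => M 0 0 (lift 0 0) * mu l).
  by apply: polynomialM => //; apply: polynomial_cst.
move=> l; rewrite (det_cmx_col_op _ (t l)) // ?row1.
  by rewrite muE quat_normsqM rmorphM.
by rewrite /t mulrA mulrN bc mulN1r subrr.
Qed.

(** * Characteristic maps *)

Lemma quat_norm_sqrtC {R : realType} (q : quat R) :
  (quat_norm q)%:C%C = sqrtC (quat_normsq q)%:C%C.
Proof.
have q0 := quat_normsq_ge0 q.
by rewrite -[in RHS](sqr_sqrtr q0) rmorphXn sqrCK // lecR sqrtr_ge0.
Qed.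

Theorem theorem33 (R : realType) (A : 'M[quat R]_3)
    (hA : exists i j : 'I_3, i != j /\ A i j = 0) :
  exists mu : quat R -> quat R, polynomial_map mu /\ characteristic_map A mu.
Proof.
have [i [j [neq_ij Aij]]] := hA.
have [s s0 s2] : exists2 s : 'S_3, s 0 = i & s ord_max = j.
  (* The transposition of 0 and i sends 0 to i; before it, the transposition of
     2 and k puts at index 2 the preimage k of j, and fixes 0 as k <> 0. *)
  pose k := tperm 0 i j.
  have k0 : k != 0.
    by rewrite -(inj_eq (@perm_inj _ (tperm 0 i))) tpermK tpermL eq_sym.
  exists (tperm ord_max k * tperm 0 i)%g; rewrite permM.
    by rewrite (@tpermD _ ord_max) // tpermL.
  by rewrite tpermL tpermK.
have [|mu mupoly muE] := det_cmx_hessenberg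
    (fun l => \matrix_(a, b) (A - l%:M) (s a) (s b)).
  split=> [a b|l a b ab|l a b ab].
  - have [<-|ab] := eqVneq a b.
      apply: (polynomial_ext (fun l => A (s a) (s a) + l * - 1)).
        by move=> l; rewrite !mxE eqxx mulrN1.
      apply: polynomialD; first exact: polynomial_cst.
      by apply: polynomialM polynomial_id _; apply: polynomial_cst.
    apply: polynomial_ext (polynomial_cst (A (s a) (s b))) => l.
    by rewrite !mxE (inj_eq perm_inj) (negPf ab) subr0.
  - have [-> ->] : a = 0 /\ b = ord_max.
      by case: a b ab => [[|[|[|a]]] ?] [[|[|[|b]]] ?] // _; split; apply: val_inj.
    by rewrite !mxE s0 s2 Aij (negPf neq_ij) subr0.
  - have ne : a != b by rewrite -val_eqE /= ab neq_ltn ltnSn.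
    by rewrite !mxE (inj_eq perm_inj) (negPf ne).
exists mu; split=> //; exists 1; first exact: ltr01.
by move=> l; rewrite mul1r /Sdet -(det_cmx_mxsub s s) muE quat_norm_sqrtC.
Qed.
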